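(* There is a constant $C>0$ such that for all integers $n\ge 1$ and $m\ge 1$, with $N=2^n$, and every data sequence $d_0,\dots,d_{N-1}\in\{0,1\}^m$, there exists a quantum circuit acting on an $n$-qubit selection register, an $m$-qubit target register and $n$ dirty ancilla qubits, consisting of Toffoli gates and Clifford gates, that implements the QROM read $$|i\rangle|y\rangle\mapsto|i\rangle|y\oplus d_i\rangle,\qquad i\in\{0,\dots,N-1\},\ y\in\{0,1\}^m,$$ (extended linearly), using at most $1.25N+C\,n\sqrt{N}$ Toffoli gates.
   Context: The selection register stores the integer $i$ in binary, and $\oplus$ is bitwise XOR. QROM is the case of unary iteration $\sum_{i}|i\rangle\langle i|\otimes V_i$ in which each $V_i$ is the product of Pauli $X$ gates on the target qubits where $d_i$ has a $1$. A Toffoli gate with controls $x,y$ and target $z$ (three distinct qubits) maps $|x,y,z\rangle\mapsto|x,y,z\oplus (x\wedge y)\rangle$. A dirty ancilla qubit is a qubit in an arbitrary unknown initial state (possibly entangled with other qubits) that may be used as workspace but must be restored; that is, the whole circuit acts as the stated map on the selection and target registers tensored with the identity on the dirty ancillae. *)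

(* Defs.v *)
From HB Require Import structures.
From mathcomp Require Import all_boot all_order all_algebra.
From mathcomp Require Import complex reals.

Set Implicit Arguments.
Unset Strict Implicit.
Unset Printing Implicit Defensive.

Import Order.TTheory GRing.Theory Num.Theory.
Local Open Scope ring_scope.

Section Circuits.
Variables (R : realType) (Q : finType).

Definition basis := {ffun Q -> bool}.

(* Amplitude vectors of the qubits in Q.  The regular module [R[i]^o] makes
   [*:] scaling by complex numbers: [R[i]] itself is canonically a module over
   the real field R. *)
Definition state := {ffun basis -> R[i]^o}.

Definition ket (b : basis) : state := [ffun b' => (b' == b)%:R].

(* The linear operator sending [ket b] to [f b]. *)
Definition linext (f : basis -> state) (psi : state) : state :=
  \sum_(b : basis) psi b *: f b.

Definition upd (b : basis) (q : Q) (v : bool) : basis :=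
  [ffun q' => if q' == q then v else b q'].

(* The Clifford gates are given by the standard generators H, S and CNOT of the
   Clifford group (up to global phase); in particular Pauli X is H S S H. *)
Inductive gate :=
  | Hadamard of Q
  | Phase of Q
  | CNOT of Q & Q
  | Toffoli of Q & Q & Q.

(* The qubits of a gate must be distinct: CNOT q q, say, is not unitary. *)
Definition wf_gate (g : gate) : bool :=
  match g with
  | Hadamard _ | Phase _ => true
  | CNOT c t => c != t
  | Toffoli x y z => uniq [:: x; y; z]
  end.

Definition gate_ket (g : gate) (b : basis) : state :=
  match g with
  | Hadamard q =>
      (Num.sqrt 2%:R)^-1%:C%C *:
        (ket (upd b q false) + (-1) ^+ b q *: ket (upd b q true))
  | Phase q => 'i%C ^+ b q *: ket b
  | CNOT c t => ket (upd b t (b t (+) b c))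
  | Toffoli x y z => ket (upd b z (b z (+) (b x && b y)))
  end.

Definition apply_gate (psi : state) (g : gate) : state :=
  linext (gate_ket g) psi.

(* Gates are applied from the head of the list to its tail. *)
Definition circuit := seq gate.

Definition wf_circuit (c : circuit) : bool := all wf_gate c.

Definition run (c : circuit) (psi : state) : state := foldl apply_gate psi c.

Definition is_toffoli (g : gate) : bool :=
  if g is Toffoli _ _ _ then true else false.

Definition toffoli_count (c : circuit) : nat := count is_toffoli c.

Lemma linext_linear f : linear (linext f).
Proof.
move=> a u v; rewrite /linext scaler_sumr -big_split /=.
by apply: eq_bigr => b _; rewrite !ffunE scalerDl scalerA.
Qed.

Lemma linext_ket f b : linext f (ket b) = f b.
Proof.
rewrite /linext (bigD1 b) //= ffunE eqxx scale1r big1 ?addr0 // => b' nb.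
by rewrite ffunE (negPf nb) scale0r.
Qed.

Lemma run_linear c : linear (run c).
Proof.
move=> a u v; elim: c u v => //= g c IHc u v.
by rewrite -IHc /apply_gate linext_linear.
Qed.

End Circuits.

Section QROM.
Variables (n m : nat).

(* Selection, target and dirty ancilla registers, in this order. *)
Definition qubit : finType := ('I_n + 'I_m + 'I_n)%type.

(* Bit k (least significant first) of the binary expansion of i. *)
Definition bit (i k : nat) : bool := odd (i %/ 2 ^ k).

(* The basis label |i>|y>|a>. *)
Definition registers (i : 'I_(2 ^ n)) (y : {ffun 'I_m -> bool})
    (a : {ffun 'I_n -> bool}) : basis qubit :=
  [ffun q : qubit => match q with
                     | inl (inl k) => bit i k
                     | inl (inr j) => y j
                     | inr l => a l
                     end].

Definition xorf (y z : {ffun 'I_m -> bool}) : {ffun 'I_m -> bool} :=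
  [ffun j => y j (+) z j].

(* Since [run R c] is linear (run_linear) and the kets |i>|y>|a> form a basis,
   this says that c acts on every state, with the ancillae possibly entangled
   with anything else, as the QROM read tensored with the identity. *)
Definition implements_qrom (R : realType) (c : circuit qubit)
    (d : 'I_(2 ^ n) -> {ffun 'I_m -> bool}) : Prop :=
  forall i y a,
    run c (ket R (registers i y a)) = ket R (registers i (xorf y (d i)) a).

End QROM.

(* Main.v *)
(** Split the address into [h = uphalf n] high and [k = n./2] low bits, and keep
    a flag A that holds a + [high bits = p], with a unknown, for each prefix p in
    turn; changing p costs O(n) Toffoli gates.  For fixed p, a binary tree on the
    low bits, with one dirty flag per level, adds (flag A) * (row p of the data)
    to the target with only 2^k - 1 Toffoli gates.  Nothing is uncomputed inside
    the tree.  Instead, one level below a flag s, with low bit x and dirty flag f,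
    read y + f H(low bits) in place of the target y: toggling f by a function g
    adds g H to this virtual target, and replacing H by H' is a lookup of H + H'
    controlled by f, done by the next level.  Two toggles of f, by s x (one
    Toffoli) and by s (one CNOT), with H set to F_0 + F_1 and then to F_0, add
    s (F_0 + x F_1), and the cost satisfies T(k) = 1 + 2 T(k-1).  The functions H
    stay as a debt that the next pulse takes over; a last pulse with data 0 clears
    it.  A pulse with flag s toggles the flags of the tree by s times fixed
    functions of the address, so they are restored when all s used sum to 0.  The
    total is 2^n + O(n 2^(n/2)) Toffoli gates. *)

Require Import Defs.
From mathcomp Require Import all_boot all_order all_algebra.
From mathcomp Require Import complex reals.
From mathcomp Require Import zify ring.

Import Order.TTheory GRing.Theory Num.Theory.
Local Open Scope ring_scope.

(** * Classical circuits of controlled NOT gates and their compilation to Toffoli and Clifford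
    gates *)

Section ReversibleCircuits.
Local Set Implicit Arguments.
Local Unset Strict Implicit.
Variable Q : finType.

(* A NOT gate with the given controls, and its target. *)
Definition cgate : Type := (seq Q * Q)%type.

Definition cact (b : basis Q) (g : cgate) : basis Q :=
  [ffun q => b q (+) ((q == g.2) && all b g.1)].

Definition crun (c : seq cgate) (b : basis Q) : basis Q := foldl cact b c.

Definition wf_cgate (g : cgate) : bool :=
  (size g.1 <= 2)%N && uniq (g.2 :: g.1).

Definition ccount (c : seq cgate) : nat :=
  count (fun g : cgate => (1 < size g.1)%N) c.

Arguments crun : simpl never.
Arguments ccount : simpl never.

(** Controls beyond the second would be dropped here; [wf_cgate] excludes such gates. *)
Definition compile_gate (g : cgate) : circuit Q :=
  let t := g.2 in
  match g.1 with
  | [::] => [:: Hadamard t; Phase t; Phase t; Hadamard t]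
  | [:: x] => [:: CNOT x t]
  | [:: x, y & _] => [:: Toffoli x y t]
  end.

Definition compile (c : seq cgate) : circuit Q :=
  flatten [seq compile_gate g | g <- c].

Lemma crun_cat c1 c2 b : crun (c1 ++ c2) b = crun c2 (crun c1 b).
Proof. exact: foldl_cat. Qed.

Lemma crun_cons g c b : crun (g :: c) b = crun c (cact b g).
Proof. by []. Qed.

Lemma crun1 g b : crun [:: g] b = cact b g.
Proof. by []. Qed.

Lemma crun_rcons g c b : crun (rcons c g) b = cact (crun c b) g.
Proof. exact: foldl_rcons. Qed.

Lemma cactE b g q : cact b g q = b q (+) ((q == g.2) && all b g.1).
Proof. by rewrite ffunE. Qed.

Lemma ccount_cat c1 c2 : ccount (c1 ++ c2) = (ccount c1 + ccount c2)%N.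
Proof. exact: count_cat. Qed.

(** No gate of the fan-out changes a control, so all of them fire together. With [cs] empty this
    negates a set of qubits; with one flag as control it writes a data row. *)
Lemma crun_fanout cs ts b q : uniq ts -> {in ts, forall t, t \notin cs} ->
  crun [seq (cs, t) | t <- ts] b q = b q (+) ((q \in ts) && all b cs).
Proof.
elim: ts b => [|t ts IHts] b /=; first by rewrite addbF.
case/andP=> nt uts dts.
have tcs : t \notin cs by apply: dts; rewrite inE eqxx.
rewrite crun_cons IHts //; last by move=> u uts'; apply: dts; rewrite inE uts' orbT.
have -> : all (cact b (cs, t)) cs = all b cs.
  apply: eq_in_all => c cin; rewrite cactE /=.
  by case: eqP cin => [->|_ _]; [rewrite (negPf tcs) | rewrite addbF].
rewrite cactE /= inE; case: eqP => [->|_] /=; last by rewrite addbF.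
by rewrite (negPf nt) addbF.
Qed.

Lemma wf_compile c : all wf_cgate c -> wf_circuit (compile c).
Proof.
elim: c => //= -[cs t] c IHc /andP[/andP[/= scs /andP[tcs ucs]] /IHc wc].
rewrite /compile /= /wf_circuit all_cat; apply/andP; split; last exact: wc.
case: cs scs tcs ucs => [|x [|y [|//]]] //= _.
  by rewrite inE eq_sym => ->.
rewrite !inE !negb_or !andbT => /andP[tx ty] xy.
by rewrite xy (eq_sym x) tx eq_sym ty.
Qed.

Lemma toffoli_compile c : toffoli_count (compile c) = ccount c.
Proof.
elim: c => //= -[cs t] c IHc.
rewrite /compile /= /toffoli_count count_cat [X in (_ + X)%N]IHc /ccount /=.
by case: cs => [|x [|y cs]].
Qed.

Variable R : realType.

Lemma sqrt2_complex :
  ((Num.sqrt 2%:R)^-1%:C%C * (Num.sqrt 2%:R)^-1%:C%C : R[i]) = 2%:R^-1.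
Proof.
rewrite -rmorphM /= -invfM -expr2 sqr_sqrtr ?ler0n //.
by rewrite fmorphV /= rmorph_nat.
Qed.

(** Two phase gates give the sign (-1)^b between the Hadamard gates, so the two paths to each basis
    state have amplitudes 1/2 and 1/2, or 1/2 and -1/2: only the flipped bit survives. *)
Lemma run_not (q : Q) (b : basis Q) :
  run (compile_gate ([::], q)) (ket R b) = ket R (upd b q (~~ b q)).
Proof.
set r : R[i]^o := (Num.sqrt 2%:R)^-1%:C%C.
have had b' : apply_gate (ket R b') (Hadamard q) =
    r *: (ket R (upd b' q false) + (-1) ^+ b' q *: ket R (upd b' q true)).
  exact: linext_ket.
have phs b' : apply_gate (ket R b') (Phase q) = 'i%C ^+ b' q *: ket R b'.
  exact: linext_ket.
have apL (a : R[i]) (u v : state R Q) (g : gate Q) : apply_gate (a *: u + v) g = a *: apply_gate u g + apply_gate v g.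
  exact: linext_linear.
have ap0 (g : gate Q) : apply_gate (0 : state R Q) g = 0.
  by rewrite /apply_gate /linext big1 // => b' _; rewrite ffunE scale0r.
have apZ (a : R[i]) (u : state R Q) (g : gate Q) : apply_gate (a *: u) g = a *: apply_gate u g.
  by have := apL a u 0 g; rewrite ap0 !addr0.
have apD (u v : state R Q) (g : gate Q) : apply_gate (u + v) g = apply_gate u g + apply_gate v g.
  by have := apL 1 u v g; rewrite !scale1r.
have uu v w : upd (upd b q v) q w = upd b q w.
  by apply/ffunP => q'; rewrite !ffunE; case: eqP.
have uq v : upd b q v q = v by rewrite ffunE eqxx.
have rr : r * r = 2%:R^-1 := sqrt2_complex.
rewrite /run /= had !(apZ, apD, phs, had, uq, uu) /= !expr0 !expr1 !scale1r.
rewrite !(scalerA, scalerDr).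
have ii : 'i%C * 'i%C = -1 :> R[i] by rewrite -expr2 sqr_i.
have -> : r * ((-1) ^+ b q * 'i%C * 'i%C) * r = - ((-1) ^+ b q * 2%:R^-1).
  by rewrite -rr -[_ * 'i%C * 'i%C]mulrA ii; ring.
rewrite rr addrACA -!scalerDl mulrN1 opprK.
have h1 : 2%:R^-1 + 2%:R^-1 = 1 :> R[i].
  by rewrite -[2%:R^-1]mul1r -splitr.
case: (b q) => /=; rewrite ?expr1 ?expr0.
  by rewrite !mulN1r opprK h1 subrr scale0r scale1r addr0.
by rewrite !mul1r h1 subrr scale0r scale1r add0r.
Qed.

(** Compiled circuits permute the basis kets, so everything below can be argued on bits, without
    amplitudes. *)
Lemma run_compile c b : all wf_cgate c ->
  run (compile c) (ket R b) = ket R (crun c b).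
Proof.
elim: c b => //= -[cs t] c IHc b /andP[/andP[/= scs _] /IHc wc].
rewrite /compile /= /run foldl_cat -/(run _ _) -/(run _ _) -/(compile c).
suff -> : run (compile_gate (cs, t)) (ket R b) = ket R (cact b (cs, t)) by rewrite wc.
case: cs scs => [|x [|y [|//]]] _.
- rewrite run_not; congr ket; apply/ffunP => q.
  by rewrite !ffunE /= andbT; case: eqP => [->|]; rewrite ?addbT ?addbF.
- rewrite /= /apply_gate linext_ket /=; congr ket; apply/ffunP => q.
  by rewrite !ffunE /= andbT; case: eqP => [->|]; rewrite ?addbF.
rewrite /= /apply_gate linext_ket /=; congr ket; apply/ffunP => q.
by rewrite !ffunE /= andbT; case: eqP => [->|]; rewrite ?addbF.
Qed.

End ReversibleCircuits.

Arguments crun {Q} c b : simpl never.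
Arguments ccount {Q} c : simpl never.

(** * The qubits of the three registers, and multiply controlled NOT with dirty ancillae *)

Section Lookup.
Local Set Implicit Arguments.
Local Unset Strict Implicit.
Variables n m : nat.
Implicit Types (b : basis (qubit n m)) (q : qubit n m) (s t : 'I_n).

Definition sel (i : 'I_n) : qubit n m := inl (inl i).
Definition tgt (j : 'I_m) : qubit n m := inl (inr j).
Definition anc (l : 'I_n) : qubit n m := inr l.

Lemma sel_inj : injective sel. Proof. by move=> i j []. Qed.
Lemma tgt_inj : injective tgt. Proof. by move=> i j []. Qed.
Lemma anc_inj : injective anc. Proof. by move=> i j []. Qed.

Definition selv b : {ffun 'I_n -> bool} := [ffun i => b (sel i)].

Lemma selvE b i : selv b i = b (sel i). Proof. by rewrite ffunE. Qed.

(* Pairs (selection qubit, ancilla). *)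
Implicit Types L : seq ('I_n * 'I_n).

Definition tof (x : 'I_n) s t : cgate (qubit n m) := ([:: sel x; anc s], anc t).

(** Let r be the product of the remaining controls. The inner ladder turns d into d + r between the
    two Toffoli gates, so [t] gains x d + x (d + r) = x r for unknown d. The intermediate ancillae
    stay toggled, as [ladder_flip] records. *)
Fixpoint ladder (x0 : 'I_n) L t : seq (cgate (qubit n m)) :=
  if L is (x, d) :: L' then tof x d t :: rcons (ladder x0 L' d) (tof x d t)
  else [:: ([:: sel x0], anc t)].

Fixpoint ladder_flip (x0 : 'I_n) L t (v : {ffun 'I_n -> bool}) q : bool :=
  if q == anc t then all v (x0 :: unzip1 L)
  else if L is (_, d) :: L' then ladder_flip x0 L' d v q else false.

Lemma ladder_flip_out x0 L t v q :
  (forall l, l \in t :: unzip2 L -> q != anc l) -> ladder_flip x0 L t v q = false.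
Proof.
elim: L t => [|[x d] L IHL] t /= out; rewrite (negPf (out t _)) ?inE ?eqxx //.
by apply: IHL => l lL; apply: out; rewrite inE lL orbT.
Qed.

Lemma selv_act b cs t : selv (cact b (cs, anc t)) = selv b.
Proof. by apply/ffunP => i; rewrite !ffunE /= addbF. Qed.

Lemma ladderE x0 L t b q : uniq (t :: unzip2 L) ->
  crun (ladder x0 L t) b q = b q (+) ladder_flip x0 L t (selv b) q.
Proof.
elim: L t b q => [|[x d] L IHL] t b q.
  move=> _; rewrite /= crun1 cactE /=.
  by case: (q == anc t); rewrite // selvE.
rewrite [unzip2 _]/= [uniq _]/= => /andP[tL udL].
rewrite [ladder _ _ _]/= crun_cons crun_rcons cactE /= !IHL // selv_act !cactE /=.
have td : t != d by apply: contra tL => /eqP->; rewrite inE eqxx.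
have ladd : ladder_flip x0 L d (selv b) (anc d) = all (selv b) (x0 :: unzip1 L).
  by case: L {IHL tL udL} => [|[? ?] ?] /=; rewrite eqxx.
have -> : ladder_flip x0 L d (selv b) (sel x) = false.
  by rewrite ladder_flip_out.
rewrite ladd (inj_eq anc_inj) (eq_sym d) (negPf td) !addbF !andbT /= !selvE.
case: eqP => [->|_] /=; last by rewrite !addbF.
rewrite ladder_flip_out ?addbF; last first.
  by move=> l lL; rewrite (inj_eq anc_inj); apply: contraNneq tL => ->.
by case: (b (anc t)); case: (b (sel x)); case: (b (anc d)); case: (b (sel x0));
   case: (all _ _).
Qed.

(* A ladder is an involution: the second, shorter ladder restores the dirty
   ancillae touched by the first. *)
Definition mct (x0 : 'I_n) L t : seq (cgate (qubit n m)) :=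
  ladder x0 L t ++ (if L is (_, d) :: L' then ladder x0 L' d else [::]).

Lemma mctE x0 L t b q : uniq (t :: unzip2 L) ->
  crun (mct x0 L t) b q = b q (+) ((q == anc t) && all (selv b) (x0 :: unzip1 L)).
Proof.
move=> uL; rewrite /mct crun_cat.
have selL : selv (crun (ladder x0 L t) b) = selv b.
  by apply/ffunP => i; rewrite !selvE ladderE // ladder_flip_out ?addbF.
case: L uL selL => [|[x d] L] uL selL.
  by rewrite ladderE //=; case: eqP.
rewrite ladderE; last by case/andP: uL.
rewrite selL ladderE //=; case: eqP => [->|_]; last by rewrite addbK addbF.
rewrite ladder_flip_out ?addbF // => l lL.
rewrite (inj_eq anc_inj); apply: contraTneq uL => -> /=.
by rewrite lL.
Qed.

Lemma ladder_count x0 L t : ccount (ladder x0 L t) = (2 * size L)%N.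
Proof.
elim: L t => [|[x d] L IHL] t //=.
by rewrite /ccount /= -cats1 count_cat -/(ccount _) IHL /=; lia.
Qed.

Lemma mct_count x0 L t : (ccount (mct x0 L t) <= 4 * size L)%N.
Proof.
by rewrite /mct ccount_cat ladder_count; case: L => [|[x d] L] //=; rewrite ladder_count; lia.
Qed.

Lemma ladder_wf x0 L t : uniq (t :: unzip2 L) -> all (@wf_cgate _) (ladder x0 L t).
Proof.
elim: L t => [|[x d] L IHL] t //= /andP[tL udL].
rewrite all_rcons IHL // andbT /wf_cgate /= !inE /= andbT andbb.
by rewrite (inj_eq anc_inj); apply: contra tL => /eqP->; rewrite inE eqxx.
Qed.

Lemma mct_wf x0 L t : uniq (t :: unzip2 L) -> all (@wf_cgate _) (mct x0 L t).
Proof.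
move=> uL; rewrite /mct all_cat ladder_wf //.
by case: L uL => [|[x d] L] //= /andP[_ uL]; rewrite ladder_wf.
Qed.

(** * Toggling a flag when the high bits match a given prefix *)

Definition zeros (X : seq 'I_n) (p : seq bool) : seq 'I_n :=
  [seq z.1 | z <- zip X p & ~~ z.2].

Lemma zeros_sub X p : {subset zeros X p <= X}.
Proof.
elim: X p => [|x X IHX] [|c p] //= y; rewrite /zeros /= inE.
case: c => /= [/IHX->|]; first exact: orbT.
by rewrite inE => /predU1P[->|/IHX->]; rewrite ?eqxx ?orbT.
Qed.

Lemma zeros_uniq X p : uniq X -> uniq (zeros X p).
Proof.
elim: X p => [|x X IHX] [|c p] //= /andP[xX uX]; rewrite /zeros /=.
by case: c => /=; rewrite ?IHX // andbT (contra _ xX) //; apply: zeros_sub.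
Qed.

(** NOT gates on [zeros X p] turn the test for the pattern [p] into the test that all bits are 1,
    which is the one [mct] performs. *)
Lemma all_zeros (v : 'I_n -> bool) X p : uniq X -> size p = size X ->
  all (fun x => v x (+) (x \in zeros X p)) X = ([seq v x | x <- X] == p).
Proof.
elim: X p => [|x X IHX] [|c p] //= /andP[xX uX] [sp].
rewrite eqseq_cons -IHX //; congr (_ && _).
  have xz : x \notin zeros X p by apply: contra xX; apply: zeros_sub.
  rewrite /zeros /=; case: c => /=; first by rewrite (negPf xz) addbF eqb_id.
  by rewrite inE eqxx addbT eqbF_neg.
apply: eq_in_all => y yX; congr (_ (+) _); rewrite /zeros /=.
case: c => //=; rewrite inE; case: eqP => // yx.
by rewrite yx (negPf xX) in yX.
Qed.

Definition nots (X : seq 'I_n) : seq (cgate (qubit n m)) :=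
  [seq ([::], q) | q <- map sel X].

Definition match_flip (x0 : 'I_n) L t (p : seq bool) :=
  let c := nots (zeros (x0 :: unzip1 L) p) in c ++ mct x0 L t ++ c.

Definition selbits b (X : seq 'I_n) : seq bool := [seq b (sel x) | x <- X].

Lemma match_flipE x0 L t p b q :
  uniq (t :: unzip2 L) -> uniq (x0 :: unzip1 L) -> size p = (size L).+1 ->
  crun (match_flip x0 L t p) b q =
  b q (+) ((q == anc t) && (selbits b (x0 :: unzip1 L) == p)).
Proof.
move=> uL uX sp; set X := x0 :: unzip1 L in uX *.
have notsE b' q' :
    crun (nots (zeros X p)) b' q' = b' q' (+) (q' \in map sel (zeros X p)).
  rewrite crun_fanout ?andbT // map_inj_uniq; first exact: zeros_uniq.
  exact: sel_inj.
rewrite /match_flip -/X 2!crun_cat notsE mctE // notsE.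
rewrite /selbits -all_zeros //; last by rewrite sp /= size_map.
have -> : all (selv (crun (nots (zeros X p)) b)) X =
          all (fun x => b (sel x) (+) (x \in zeros X p)) X.
  by apply: eq_all => x; rewrite selvE notsE mem_map //; apply: sel_inj.
rewrite -/X; case: (q \in _); case: (b q); case: (_ == _); case: (all _ _) => //.
Qed.

Lemma match_flip_wf x0 L t p :
  uniq (t :: unzip2 L) -> all (@wf_cgate _) (match_flip x0 L t p).
Proof.
move=> uL; have wn X : all (@wf_cgate _) (nots X) by rewrite all_map; apply/allP.
by rewrite /match_flip all_cat wn all_cat mct_wf ?wn.
Qed.

Lemma nots_count X : ccount (nots X) = 0%N.
Proof. by rewrite /ccount /nots count_map; elim: (map _ _). Qed.

Lemma match_flip_count x0 L t p : (ccount (match_flip x0 L t p) <= 4 * size L)%N.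
Proof.
by rewrite /match_flip 2!ccount_cat nots_count addn0 add0n mct_count.
Qed.

(** * Pulses: the tree lookup on the low bits, with its debt and its effect on the flags *)

Definition table := seq bool -> 'I_m -> bool.
Implicit Types F G : table.

Definition sub_table F (v : bool) : table := fun w => F (v :: w).
Definition addt F G : table := fun w j => F w j (+) G w j.

(* G is the table of the previous pulse: it determines the current debt. *)
Fixpoint pulse s L G F : seq (cgate (qubit n m)) :=
  if L is (x, a) :: L' then
    let E := addt (sub_table G false) (addt (sub_table F false) (sub_table F true)) in
    pulse a L' (sub_table G true) E ++
    tof x s a :: pulse a L' E (sub_table F true) ++ [:: ([:: anc s], anc a)]
  else [seq ([:: anc s], q) | q <- [seq tgt j | j <- enum 'I_m & F [::] j]].

(** The difference between the target and the virtual target. A pulse with table G, with halves G_0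
    and G_1, leaves H = G_0 at level [a], and its last inner pulse had table G_1. *)
Fixpoint debt L G b (j : 'I_m) : bool :=
  if L is (x, a) :: L' then
    (b (anc a) && G (false :: selbits b (unzip1 L')) j)
      (+) debt L' (sub_table G true) b j
  else false.

(** The factor of s in the toggle of each flag. Level [a] is toggled by s x and by s, in all s (1 +
    x). The two inner pulses run with flags a and a + s x, so the unknown a cancels and deeper flags
    get a factor s x. *)
Fixpoint pulse_flip L b q : bool :=
  if L is (x, a) :: L' then
    if q == anc a then ~~ b (sel x) else b (sel x) && pulse_flip L' b q
  else false.

Definition nontarget q := if q is inl (inr _) then false else true.

Lemma pulse_flip_out L b q :
  (forall l, l \in unzip2 L -> q != anc l) -> pulse_flip L b q = false.
Proof.
elim: L => [|[x a] L IHL] //= out; rewrite (negPf (out a _)) ?inE ?eqxx //.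
by rewrite IHL ?andbF // => l lL; apply: out; rewrite inE lL orbT.
Qed.

Lemma eq_pulse_flip L b b' q :
  (forall i, b (sel i) = b' (sel i)) -> pulse_flip L b q = pulse_flip L b' q.
Proof. by move=> bb'; elim: L => [|[x a] L IHL] //=; rewrite IHL bb'. Qed.

Lemma eq_selbits X b b' :
  (forall i, b (sel i) = b' (sel i)) -> selbits b X = selbits b' X.
Proof. by move=> bb'; apply: eq_map => x; apply: bb'. Qed.

Lemma eq_debt L G b b' j :
  (forall i, b (sel i) = b' (sel i)) ->
  (forall l, l \in unzip2 L -> b (anc l) = b' (anc l)) ->
  debt L G b j = debt L G b' j.
Proof.
move=> bb'; elim: L G => [|[x a] L IHL] G //= ba.
rewrite (eq_selbits _ bb') ba ?inE ?eqxx // IHL // => l lL.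
by apply: ba; rewrite inE lL orbT.
Qed.

Lemma pulse_nontarget s L G F b q : uniq (s :: unzip2 L) -> nontarget q ->
  crun (pulse s L G F) b q = b q (+) (b (anc s) && pulse_flip L b q).
Proof.
elim: L s G F b q => [|[x a] L IHL] s G F b q.
  move=> _ nq /=; rewrite crun_fanout.
  - rewrite andbF addbF; case: mapP => [[j _ qj]|_]; last by rewrite addbF.
    by rewrite qj in nq.
  - by rewrite (map_inj_uniq tgt_inj) filter_uniq ?enum_uniq.
  - by move=> t /mapP[j _ ->].
rewrite [unzip2 _]/= [uniq _]/= => /andP[saL uaL] nq.
have sa : s != a by apply: contra saL => /eqP->; rewrite inE eqxx.
have aL : a \notin unzip2 L by case/andP: uaL.
have sL : s \notin unzip2 L by apply: contra saL; rewrite inE orbC => ->.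
rewrite [pulse _ _ _ _]/= crun_cat crun_cons crun_cat crun1.
set E := addt _ _; set b1 := crun _ b; set b2 := cact b1 _.
set b3 := crun _ b2.
have b1E q' : nontarget q' -> b1 q' = b q' (+) (b (anc a) && pulse_flip L b q').
  by move=> nq'; rewrite /b1 IHL.
have b1sel i : b1 (sel i) = b (sel i) by rewrite b1E // pulse_flip_out ?andbF ?addbF.
have flL l : l \notin unzip2 L -> forall b', pulse_flip L b' (anc l) = false.
  move=> lL b'; rewrite pulse_flip_out // => l' l'L.
  by rewrite (inj_eq anc_inj); apply: contraNneq lL => ->.
have b2sel i : b2 (sel i) = b (sel i) by rewrite /b2 cactE /= addbF b1sel.
have b3E q' : nontarget q' -> b3 q' = b2 q' (+) (b2 (anc a) && pulse_flip L b q').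
  by move=> nq'; rewrite /b3 IHL //; congr (_ (+) (_ && _)); apply: eq_pulse_flip.
have b1s : b1 (anc s) = b (anc s) by rewrite b1E // flL // andbF addbF.
have b1a : b1 (anc a) = b (anc a) by rewrite b1E // flL // andbF addbF.
have b2s : b2 (anc s) = b (anc s).
  by rewrite /b2 cactE /= (inj_eq anc_inj) (negPf sa) addbF b1s.
have b2a : b2 (anc a) = b (anc a) (+) (b (sel x) && b (anc s)).
  by rewrite /b2 cactE /= eqxx b1sel b1a b1s andbT.
have b3s : b3 (anc s) = b (anc s) by rewrite b3E // flL // andbF addbF.
rewrite cactE /= andbT b3s b3E // b2a.
case: eqP => [->|qa] /=.
  rewrite flL // andbF addbF b2a.
  by case: (b (anc a)); case: (b (anc s)); case: (b (sel x)).
rewrite /b2 cactE /=; case: eqP => // _ /=; rewrite !addbF b1E //.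
by case: (b q); case: (b (anc a)); case: (b (anc s)); case: (b (sel x)); case: pulse_flip.
Qed.

(** The virtual target gains exactly s F. At level [a] the inner pulses contribute a (G_0 + F_0 +
    F_1) + (a + s x) F_1, and the debt term a G_0 becomes (a + s (1 + x)) F_0; all terms in a cancel
    and s ((1 + x) F_0 + x F_1) remains. *)
Lemma pulse_target s L G F b j : uniq (s :: unzip2 L) ->
  crun (pulse s L G F) b (tgt j) (+) debt L F (crun (pulse s L G F) b) j =
  b (tgt j) (+) debt L G b j (+) (b (anc s) && F (selbits b (unzip1 L)) j).
Proof.
elim: L s G F b => [|[x a] L IHL] s G F b.
  move=> _ /=; rewrite !addbF crun_fanout.
  - by rewrite (mem_map tgt_inj) mem_filter mem_enum /= !andbT andbC.
  - by rewrite (map_inj_uniq tgt_inj) filter_uniq ?enum_uniq.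
  - by move=> t /mapP[i _ ->].
move=> usaL; move: (usaL).
rewrite [unzip2 _]/= [uniq _]/= => /andP[saL uaL].
have sa : s != a by apply: contra saL => /eqP->; rewrite inE eqxx.
have aL : a \notin unzip2 L by case/andP: uaL.
have sL : s \notin unzip2 L by apply: contra saL; rewrite inE orbC => ->.
have selE i : crun (pulse s ((x, a) :: L) G F) b (sel i) = b (sel i).
  by rewrite pulse_nontarget // pulse_flip_out ?andbF ?addbF.
have ancE : crun (pulse s ((x, a) :: L) G F) b (anc a) =
    b (anc a) (+) (b (anc s) && ~~ b (sel x)).
  by rewrite pulse_nontarget //= eqxx.
rewrite [debt _ F _ _]/= (eq_selbits _ selE) ancE.
rewrite [pulse _ _ _ _]/= crun_cat crun_cons crun_cat.
rewrite crun1.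
set E := addt _ _; set b1 := crun _ b; set b2 := cact b1 _.
set b3 := crun _ b2.
have b1sel i : b1 (sel i) = b (sel i).
  by rewrite /b1 pulse_nontarget // pulse_flip_out ?andbF ?addbF.
have flL l : l \notin unzip2 L -> forall b', pulse_flip L b' (anc l) = false.
  move=> lL b'; rewrite pulse_flip_out // => l' l'L.
  by rewrite (inj_eq anc_inj); apply: contraNneq lL => ->.
have b2sel i : b2 (sel i) = b (sel i) by rewrite /b2 cactE /= addbF b1sel.
have b1s : b1 (anc s) = b (anc s) by rewrite /b1 pulse_nontarget // flL // andbF addbF.
have b1a : b1 (anc a) = b (anc a) by rewrite /b1 pulse_nontarget // flL // andbF addbF.
have b2a : b2 (anc a) = b (anc a) (+) (b (sel x) && b (anc s)).
  by rewrite /b2 cactE /= eqxx b1sel b1a b1s andbT.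
have I1 := IHL a (sub_table G true) E b uaL; rewrite -/b1 in I1.
have I2 := IHL a E (sub_table F true) b2 uaL; rewrite -/b3 in I2.
rewrite (eq_selbits _ b2sel) in I2.
have -> : debt L (sub_table F true) (cact b3 ([:: anc s], anc a)) j =
          debt L (sub_table F true) b3 j.
  apply: eq_debt => [i|l lL]; rewrite cactE /= ?addbF //.
  rewrite (inj_eq anc_inj); case: eqP => [la|_]; last by rewrite addbF.
  by rewrite la (negPf aL) in lL.
(* The debt below level [a] does not read the flag [a], so the second inner pulse takes over exactly
   what the first one left. *)
have D2 : debt L E b2 j = debt L E b1 j.
  apply: eq_debt => [i|l lL]; rewrite /b2 cactE /= ?addbF //.
  rewrite (inj_eq anc_inj); case: eqP => [la|_]; last by rewrite addbF.
  by rewrite la (negPf aL) in lL.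
have T2 : b2 (tgt j) = b1 (tgt j) by rewrite /b2 cactE /= addbF.
rewrite cactE /= addbF.
rewrite D2 T2 I1 b2a /E /addt /sub_table in I2.
rewrite [LHS]addbCA I2 /sub_table.
case: (b (sel x)); case: (b (anc a)); case: (b (anc s)); case: (b (tgt j));
case: (debt _ _ _ _); case: (G _ j); case: (F (true :: _) j);
case: (F (false :: _) j) => //.
Qed.

Lemma pulse_count s L G F : ccount (pulse s L G F) = (2 ^ size L).-1.
Proof.
elim: L s G F => [|[x a] L IHL] s G F /=.
  by rewrite /ccount count_map; elim: (map _ _).
rewrite ccount_cat /ccount /= -/(ccount _) IHL count_cat -/(ccount _) IHL /=.
by rewrite expnS; have := expn_gt0 2 (size L); lia.
Qed.

Lemma pulse_wf s L G F : uniq (s :: unzip2 L) -> all (@wf_cgate _) (pulse s L G F).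
Proof.
elim: L s G F => [|[x a] L IHL] s G F.
  by move=> _ /=; rewrite all_map; apply/allP => q /mapP[j _ ->].
rewrite [unzip2 _]/= [uniq _]/= => /andP[saL uaL].
have sa : s != a by apply: contra saL => /eqP->; rewrite inE eqxx.
rewrite /= all_cat IHL //= all_cat IHL //= /wf_cgate /= !inE /= !(inj_eq anc_inj).
by rewrite eq_sym sa.
Qed.

(** Hence the zero table describes the debt-free start, and a pulse with zero data ends without
    debt. *)
Lemma debt0 L b j : debt L (fun _ _ => false) b j = false.
Proof. by elim: L => [|[x a] L IHL] //=; rewrite andbF IHL. Qed.

(** * The sweep over all prefixes of high bits *)

Section Sweep.
Variables (A x0 : 'I_n) (Lh L : seq ('I_n * 'I_n)) (D : seq bool -> table).
(** A pulse changes neither the selection bits nor its own flag, so the second [match_flip] restores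
    [A]. *)
Definition masked_pulse G F (p : seq bool) : seq (cgate (qubit n m)) :=
  match_flip x0 Lh A p ++ pulse A L G F ++ match_flip x0 Lh A p.

(* The pulses with data S (the sum of all D p) and 0, on the flag A and then on
   its complement, remove the contribution of the unknown initial value of A,
   clear the debt, and make the flags used in all pulses sum to 0, so that the
   ancillae of L are restored. *)
Fixpoint sweep G S (ps : seq (seq bool)) : seq (cgate (qubit n m)) :=
  if ps is p :: ps' then masked_pulse G (D p) p ++ sweep (D p) (addt S (D p)) ps'
  else pulse A L G S ++ ([::], anc A) ::
       pulse A L S (fun _ _ => false) ++ [:: ([::], anc A)].

Lemma sweep_count G S ps :
  (ccount (sweep G S ps) <=
   size ps * (8 * size Lh + 2 ^ size L) + 2 * 2 ^ size L)%N.
Proof.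
elim: ps G S => [|p ps IHps] G S /=.
  rewrite ccount_cat pulse_count /ccount /= count_cat -/(ccount _) pulse_count /=.
  by lia.
rewrite ccount_cat /masked_pulse ccount_cat ccount_cat pulse_count.
have := match_flip_count x0 Lh A p; have := IHps (D p) (addt S (D p)).
by move: (ccount _) (ccount _) => c1 c2; rewrite mulSn; lia.
Qed.

Hypotheses (uL : uniq (A :: unzip2 L)) (uLh : uniq (A :: unzip2 Lh)).
Hypothesis uX : uniq (x0 :: unzip1 Lh).

Let high b := selbits b (x0 :: unzip1 Lh).
Let low b := selbits b (unzip1 L).

Let pulse_flipA b : pulse_flip L b (anc A) = false.
Proof.
rewrite pulse_flip_out // => l lL; rewrite (inj_eq anc_inj).
by apply: contraTneq uL => ->; rewrite /= lL.
Qed.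

Let pulse_flip_sel b i : pulse_flip L b (sel i) = false.
Proof. exact: pulse_flip_out. Qed.

Lemma masked_pulse_nontarget G F p b q : size p = (size Lh).+1 -> nontarget q ->
  crun (masked_pulse G F p) b q =
  b q (+) ((b (anc A) (+) (high b == p)) && pulse_flip L b q).
Proof.
move=> sp nq; rewrite /masked_pulse crun_cat crun_cat.
set b1 := crun _ b; set b2 := crun _ b1.
have b1E q' : b1 q' = b q' (+) ((q' == anc A) && (high b == p)).
  by rewrite /b1 match_flipE.
have b1sel i : b1 (sel i) = b (sel i) by rewrite b1E addbF.
have b2E q' : nontarget q' -> b2 q' = b1 q' (+) (b1 (anc A) && pulse_flip L b q').
  move=> nq'; rewrite /b2 pulse_nontarget //.
  by congr (_ (+) (_ && _)); apply: eq_pulse_flip.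
have hb2 : high b2 = high b.
  by apply: eq_selbits => i; rewrite b2E // pulse_flip_sel andbF addbF.
rewrite match_flipE // -/(high b2) hb2 b2E // !b1E eqxx /=.
case: eqP => [->|_]; last by rewrite !addbF.
by rewrite pulse_flipA !andbF !addbF addbK.
Qed.

Lemma masked_pulse_target G F p b j : size p = (size Lh).+1 ->
  crun (masked_pulse G F p) b (tgt j)
    (+) debt L F (crun (masked_pulse G F p) b) j =
  b (tgt j) (+) debt L G b j (+) ((b (anc A) (+) (high b == p)) && F (low b) j).
Proof.
move=> sp; rewrite /masked_pulse crun_cat crun_cat.
set b1 := crun _ b; set b2 := crun _ b1.
have b1E q' : b1 q' = b q' (+) ((q' == anc A) && (high b == p)).
  by rewrite /b1 match_flipE.
have b1sel i : b1 (sel i) = b (sel i) by rewrite b1E addbF.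
have ancL l : l \in unzip2 L -> (anc l == anc A) = false.
  move=> lL; rewrite (inj_eq anc_inj); apply/eqP => lA.
  by move: uL; rewrite -lA /= lL.
rewrite match_flipE //= addbF.
rewrite (@eq_debt _ _ (crun _ b2) b2) => [|i|l lL]; last first.
- by rewrite match_flipE // ancL ?addbF.
- by rewrite match_flipE // addbF.
rewrite pulse_target // b1E /= addbF b1E eqxx /= (eq_selbits _ b1sel).
congr (_ (+) _ (+) _); apply: eq_debt => // l lL.
by rewrite b1E ancL // addbF.
Qed.

(** All pulses toggle by their flag value times the same [pulse_flip], so only the sum of the flag
    values matters: A + [high = p] for each prefix, and A + (A + 1) = 1 from the two closing
    pulses. *)
Lemma sweep_nontarget G S ps b q :
  uniq ps -> all (fun p => size p == (size Lh).+1) ps -> nontarget q ->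
  crun (sweep G S ps) b q =
  b q (+) (((b (anc A) && odd (size ps)) (+) ~~ (high b \in ps))
            && pulse_flip L b q).
Proof.
move=> + + nq; elim: ps G S b => [|p ps IHps] G S b /=.
  move=> _ _; rewrite crun_cat crun_cons crun_cat crun1 !cactE /= !andbT.
  rewrite !pulse_nontarget // !cactE /= eqxx andbT.
  have fl q' : pulse_flip L (cact (crun (pulse A L G S) b) ([::], anc A)) q' =
               pulse_flip L b q'.
    apply: eq_pulse_flip => i.
    by rewrite cactE /= addbF pulse_nontarget // pulse_flip_sel andbF addbF.
  rewrite fl !pulse_nontarget // pulse_flipA andbF !addbF ?in_nil ?andbF /=.
  case: eqP => [->|_]; first by rewrite pulse_flipA !andbF !addbF addbK.
  by case: (b q); case: (b (anc A)); case: (pulse_flip _ _ _).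
case/andP=> pps ups /andP[/eqP sp sps].
rewrite crun_cat IHps //; set b1 := crun _ b.
have b1E q' : nontarget q' -> b1 q' =
    b q' (+) ((b (anc A) (+) (high b == p)) && pulse_flip L b q').
  by move=> nq'; rewrite /b1 masked_pulse_nontarget.
have b1sel i : b1 (sel i) = b (sel i) by rewrite b1E // pulse_flip_sel andbF addbF.
have hb1 : high b1 = high b := eq_selbits _ b1sel.
rewrite hb1 b1E // (eq_pulse_flip _ _ b1sel) b1E // pulse_flipA andbF addbF inE.
case: eqP => [->|_] /=; first rewrite (negPf pps) /=;
  by case: (b q); case: (b (anc A)); case: (odd _); case: (pulse_flip _ _ _);
     case: (high b \in ps).
Qed.

(** In the induction [S] accumulates the tables already visited. The pulse for p adds (A +
    [high = p]) D p; its part A D p is cancelled by the closing pulse with data [S], and the other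
    part fires at most once since [ps] is duplicate-free. *)
Lemma sweep_target G S ps b j :
  uniq ps -> all (fun p => size p == (size Lh).+1) ps ->
  crun (sweep G S ps) b (tgt j) =
  b (tgt j) (+) debt L G b j (+) (b (anc A) && S (low b) j)
    (+) ((high b \in ps) && D (high b) (low b) j).
Proof.
elim: ps G S b => [|p ps IHps] G S b /=.
  move=> _ _; rewrite crun_cat crun_cons crun_cat crun1 cactE /= addbF.
  set b1 := crun _ b; set b2 := cact b1 _.
  have := pulse_target S (fun _ _ => false) b2 j uL.
  rewrite debt0 addbF => ->.
  have := pulse_target G S b j uL; rewrite -/b1 => <-.
  rewrite andbF !addbF /b2 cactE /= addbF; congr (_ (+) _).
  apply: eq_debt => [i|l lL]; rewrite cactE /= ?addbF //.
  rewrite (inj_eq anc_inj); case: eqP => [lA|_]; last by rewrite addbF.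
  by move: uL; rewrite -lA /= lL.
case/andP=> pps ups /andP[/eqP sp sps].
rewrite crun_cat IHps //; set b1 := crun _ b.
have b1E q' : nontarget q' -> b1 q' =
    b q' (+) ((b (anc A) (+) (high b == p)) && pulse_flip L b q').
  by move=> nq'; rewrite /b1 masked_pulse_nontarget.
have b1sel i : b1 (sel i) = b (sel i) by rewrite b1E // pulse_flip_sel andbF addbF.
have hb1 : high b1 = high b := eq_selbits _ b1sel.
have lb1 : low b1 = low b := eq_selbits _ b1sel.
rewrite masked_pulse_target // hb1 lb1 b1E // pulse_flipA andbF addbF inE /addt.
case: eqP => [->|_] /=; first rewrite (negPf pps) /=;
  by case: (b (tgt j)); case: (b (anc A)); case: (debt _ _ _ _);
     case: (S _ _); case: (D _ _ _); case: (high b \in ps);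
     case: (D (high b) _ _).
Qed.

Lemma sweep_wf G S ps : all (@wf_cgate _) (sweep G S ps).
Proof.
elim: ps G S => [|p ps IHps] G S /=.
  by rewrite all_cat pulse_wf //= all_cat pulse_wf.
by rewrite all_cat IHps /masked_pulse all_cat all_cat pulse_wf // match_flip_wf.
Qed.

End Sweep.
End Lookup.

(** * Data rows indexed by low and high address bits *)

Section BinaryAddress.
Local Set Implicit Arguments.
Local Unset Strict Implicit.
Variables n m : nat.

Definition nat_of_bits (w : seq bool) : nat :=
  foldr (fun (c : bool) r => c + r.*2)%N 0%N w.

Lemma nat_of_bitsK k i : (i < 2 ^ k)%N ->
  nat_of_bits [seq bit i l | l <- iota 0 k] = i.
Proof.
elim: k i => [|k IHk] i; first by rewrite expn0 ltnS leqn0 => /eqP.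
move=> ik; rewrite /= -(addn0 1%N) iotaDl -map_comp.
rewrite -[RHS]odd_double_half {1}/bit expn0 divn1; congr (_ + _.*2)%N.
rewrite -[RHS]IHk; last by move: ik; rewrite expnS; lia.
congr nat_of_bits; apply: eq_map => l /=.
by rewrite /bit add1n expnS divnMA divn2.
Qed.

Variable d : 'I_(2 ^ n) -> {ffun 'I_m -> bool}.

(** Bits come least significant first, so the low part [w] precedes the prefix [p]. The default
    [false] makes the table total on bit strings that encode no address. *)
Definition entry (p : seq bool) : table m := fun w j =>
  if insub (nat_of_bits (w ++ p)) is Some i then d i j else false.

Lemma entryE k (i : 'I_(2 ^ n)) (y : {ffun 'I_m -> bool}) a :
  entry (selbits (registers i y a) (drop k (enum 'I_n)))
        (selbits (registers i y a) (take k (enum 'I_n))) =1 d i.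
Proof.
move=> j; rewrite /entry /selbits -map_cat cat_take_drop.
have -> : [seq registers i y a (sel m x) | x <- enum 'I_n] =
          [seq bit i l | l <- iota 0 n].
  by rewrite -val_enum_ord -map_comp; apply: eq_map => x; rewrite /= ffunE.
by rewrite nat_of_bitsK // valK.
Qed.

End BinaryAddress.

(** * Assembly of the circuit and the Toffoli count *)

Lemma qrom_nat (R : realType) (n m : nat) (d : 'I_(2 ^ n) -> {ffun 'I_m -> bool}) :
  (0 < n)%N ->
  exists2 c : circuit (qubit n m), wf_circuit c /\ implements_qrom R c d &
    (toffoli_count c <= 2 ^ n + 18 * n * 2 ^ n./2)%N.
Proof.
move=> n0; set k := n./2; set h := uphalf n; set E := enum 'I_n.
have sE : size E = n by rewrite /E size_enum_ord.
have uE : uniq E by apply: enum_uniq.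
have hk : (k + h = n)%N by rewrite /k /h; lia.
(* The larger half goes to the prefix, so some high bit exists even for n = 1, where the tree is
   empty. *)
have h0 : (0 < h)%N by rewrite /h; lia.
have [A [ds Eds]] : exists A ds, E = A :: ds.
  have : (0 < size E)%N by rewrite sE.
  by case: (E) => // A ds _; exists A, ds.
have [x0 [xs Exs]] : exists x0 xs, drop k E = x0 :: xs.
  have : (0 < size (drop k E))%N by rewrite size_drop sE; lia.
  by case: (drop k E) => // x0 xs _; exists x0, xs.
have sds : size ds = n.-1 by move: sE; rewrite Eds => /(congr1 predn).
have sxs : size xs = h.-1.
  by have := size_drop k E; rewrite Exs sE /=; lia.
have uAds l : uniq (A :: take l ds).
  by rewrite (@subseq_uniq _ _ E) // Eds /= eqxx take_subseq.
set L := zip (take k E) (take k ds); set Lh := zip xs (take h.-1 ds).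
have szk : size (take k E) = size (take k ds).
  by rewrite !size_takel // ?sE ?sds /k; lia.
have szh : size xs = size (take h.-1 ds) by rewrite size_takel // sds; lia.
have L1 : unzip1 L = take k E by rewrite unzip1_zip ?szk.
have L2 : unzip2 L = take k ds by rewrite unzip2_zip ?szk.
have Lh1 : unzip1 Lh = xs by rewrite unzip1_zip ?szh.
have Lh2 : unzip2 Lh = take h.-1 ds by rewrite unzip2_zip ?szh.
have uL : uniq (A :: unzip2 L) by rewrite L2.
have uLh : uniq (A :: unzip2 Lh) by rewrite Lh2.
have uX : uniq (x0 :: unzip1 Lh) by rewrite Lh1 -Exs drop_uniq.
have sLh : (size Lh).+1 = h by rewrite -(size_map fst) -/(unzip1 Lh) Lh1 sxs; lia.
have sL : size L = k by rewrite -(size_map fst) -/(unzip1 L) L1 size_takel // sE; lia.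
pose ps := [seq tval p | p <- enum {: h.-tuple bool}].
have ups : uniq ps by rewrite map_inj_uniq ?enum_uniq //; apply: val_inj.
have sps : size ps = (2 ^ h)%N by rewrite size_map -cardE card_tuple card_bool.
have aps : all (fun p : seq bool => size p == (size Lh).+1) ps.
  by apply/allP => p /mapP[p' _ ->]; rewrite size_tuple sLh.
have mps p : size p = h -> p \in ps.
  by move=> /eqP sp; apply/mapP; exists (Tuple sp); rewrite ?mem_enum.
pose F0 : table m := fun _ _ => false.
pose c := sweep A x0 Lh L (entry d) F0 F0 ps.
exists (compile c).
  split; first exact/wf_compile/sweep_wf.
  move=> i y a; rewrite run_compile; last exact: sweep_wf.
  congr ket; apply/ffunP => q; set b := registers i y a.
  have hin : selbits b (x0 :: unzip1 Lh) \in ps.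
    by apply: mps; rewrite size_map /= Lh1 sxs; lia.
  have [nq|] := boolP (nontarget q).
    (* The number 2^h of prefixes is even since h > 0, so the unknown value of [A] drops out and
       every ancilla is restored. *)
    rewrite sweep_nontarget // hin sps oddX /= gtn_eqF // andbF andFb addbF.
    by rewrite !ffunE; case: q nq => [[]|].
  case: q => [[]|] // j _; rewrite sweep_target // hin debt0 andbF !addbF.
  by rewrite L1 Lh1 -Exs entryE !ffunE.
rewrite toffoli_compile; apply: leq_trans (sweep_count A x0 Lh L (entry d) F0 F0 ps) _.
rewrite sps sL mulnDr -expnD (addnC h) hk (addnC _ (2 ^ n)%N) -addnA leq_add2l.
have : (2 ^ h <= 2 * 2 ^ k)%N by rewrite -expnS leq_exp2l // /h /k; lia.
have : (size Lh <= n)%N by lia.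
have := expn_gt0 2 k; move: (2 ^ h)%N (2 ^ k)%N (size Lh) => P q l q0 ln Pq.
(* The constant 18: 16 from the two [match_flip] per prefix, using 2^h <= 2 * 2^k, and 2 from the
   closing pulses. *)
have : (P * (8 * l) <= 2 * q * (8 * n))%N by apply: leq_mul; lia.
by nia.
Qed.

Theorem mainTheorem5 (R : realType) :
  exists K : R, 0 < K /\
    forall (n m : nat), (1 <= n)%N -> (1 <= m)%N ->
    forall d : 'I_(2 ^ n) -> {ffun 'I_m -> bool},
    exists c : circuit (qubit n m),
      [/\ wf_circuit c,
          implements_qrom R c d
        & (toffoli_count c)%:R <=
            5%:R / 4%:R * (2 ^ n)%:R + K * n%:R * Num.sqrt (2 ^ n)%:R].
Proof.
exists 18%:R; split=> // n m n0 _ d.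
have [c [wfc impc] countc] := qrom_nat R n m d n0.
exists c; split=> //.
have le_sqrt : (2 ^ n./2)%:R <= Num.sqrt (2 ^ n)%:R :> R.
  rewrite -[X in X <= _]ger0_norm // -sqrtr_sqr ler_wsqrtr // -natrX ler_nat.
  by rewrite -expnM leq_exp2l //; lia.
apply: (@le_trans _ _ (2 ^ n + 18 * n * 2 ^ n./2)%:R); first by rewrite ler_nat.
rewrite natrD !natrM lerD //.
  (* The leading coefficient obtained is 1, which is at most 5/4. *)
  by rewrite ler_peMl // ler_pdivlMr ?mul1r ?ler_nat.
by rewrite ler_wpM2l // mulr_ge0.
Qed.
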